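(* Let $R$ be a finite commutative ring with nonzero identity which is weak nil clean. Then $\{1,2\}$ (where $2=1+1\in R$) is a dominating set for the nil clean graph $G_N(R)$.
   Context: An element $r$ of a ring $R$ is nil clean if $r=n+e$ for some nilpotent $n\in R$ and some idempotent $e\in R$. A ring $R$ is weak nil clean if every $r\in R$ can be written as $r=n+e$ or $r=n-e$ with $n\in R$ nilpotent and $e\in R$ idempotent. The nil clean graph $G_N(R)$ is the simple undirected graph (no loops) with vertex set $R$ in which two distinct vertices $x,y$ are adjacent if and only if $x+y$ is a nil clean element of $R$. A subset $S$ of the vertex set of a graph $G$ is a dominating set if every vertex $x$ of $G$ either lies in $S$ or is adjacent to some $y\in S$. *)

(* Defs.v *)
From HB Require Import structures.
From mathcomp Require Import all_boot all_order all_algebra.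
Set Implicit Arguments.
Unset Strict Implicit.
Unset Printing Implicit Defensive.
Import GRing.Theory.
Local Open Scope ring_scope.

Definition nilpotent_elt (R : pzRingType) (x : R) : Prop :=
  exists k : nat, x ^+ k = 0.

Definition idempotent_elt (R : pzRingType) (x : R) : Prop := x * x = x.

Definition nil_clean (R : pzRingType) (r : R) : Prop :=
  exists n e : R, [/\ nilpotent_elt n, idempotent_elt e & r = n + e].

Definition weak_nil_clean_ring (R : pzRingType) : Prop :=
  forall r : R, exists n e : R,
    [/\ nilpotent_elt n, idempotent_elt e & r = n + e \/ r = n - e].

(* The whole type V is the vertex set. *)
Record simple_graph (V : Type) := SimpleGraph {
  adj : V -> V -> Prop;
  adj_sym : forall x y, adj x y -> adj y x;
  adj_irrefl : forall x, ~ adj x x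
}.

Definition dominating_set (V : Type) (G : simple_graph V) (S : {pred V}) : Prop :=
  forall x : V, x \in S \/ exists2 y : V, y \in S & adj G x y.

Definition nil_clean_adj (R : pzRingType) (x y : R) : Prop :=
  x <> y /\ nil_clean (x + y).

Lemma nil_clean_adj_sym (R : pzRingType) (x y : R) :
  nil_clean_adj x y -> nil_clean_adj y x.
Proof. by case=> nxy cxy; split; [move/esym | rewrite addrC]. Qed.

Lemma nil_clean_adj_irrefl (R : pzRingType) (x : R) : ~ nil_clean_adj x x.
Proof. by case. Qed.

Definition nil_clean_graph (R : pzRingType) : simple_graph R :=
  SimpleGraph (@nil_clean_adj_sym R) (@nil_clean_adj_irrefl R).

(* Main.v *)
Require Import Defs.
From HB Require Import structures.
From mathcomp Require Import all_boot all_order all_algebra.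
From mathcomp Require Import ring.
Set Implicit Arguments.
Unset Strict Implicit.
Unset Printing Implicit Defensive.
Import GRing.Theory.
Local Open Scope ring_scope.

(** If [x = n - e], then [x + 1 = n + (1 - e)] is nil clean. If [x = n + e],
    decompose [2e - 1] as [n' + f] or [n' - f]; since [(2e - 1)^2 = 1], the
    element [1 - f] is nilpotent, so [2e] or [2e - 2] is nilpotent. In the first
    case [e + 1 = (1 - e) + 2e] is nil clean. In the second, [e + 2] is [3e] up
    to a nilpotent, and [3] is itself nil clean: if [3 = m - g], then
    [12 = 3 + 3^2] is nilpotent, hence so is [6], and [3 = (6 - m) + g]. *)

Lemma nilpotent_mulr (R : comNzRingType) (x y : R) :
  nilpotent_elt x -> nilpotent_elt (x * y).
Proof. by case=> k xk0; exists k; rewrite exprMn xk0 mul0r. Qed.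

Lemma nilpotent_opp (R : comNzRingType) (x : R) :
  nilpotent_elt x -> nilpotent_elt (- x).
Proof. by rewrite -mulrN1; apply: nilpotent_mulr. Qed.

(** In the binomial expansion of [(x + y) ^+ (i + j)], each term contains either [x] to a power at
    least [i] or [y] to a power at least [j]. *)
Lemma nilpotent_add (R : comNzRingType) (x y : R) :
  nilpotent_elt x -> nilpotent_elt y -> nilpotent_elt (x + y).
Proof.
case=> i xi0 [j yj0]; exists (i + j)%N; rewrite exprDn big1 // => -[k /= _] _.
have [le_kj | /ltnW le_jk] := leqP k j.
  by rewrite -addnBA // exprD xi0 !mul0r mul0rn.
by rewrite -(subnKC le_jk) (exprD y) yj0 mul0r mulr0 mul0rn.
Qed.

Lemma nilpotent_sub (R : comNzRingType) (x y : R) :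
  nilpotent_elt x -> nilpotent_elt y -> nilpotent_elt (x - y).
Proof. by move=> nx /nilpotent_opp; apply: nilpotent_add. Qed.

Lemma nilpotent_sqr (R : comNzRingType) (x : R) :
  nilpotent_elt (x ^+ 2) -> nilpotent_elt x.
Proof. by case=> k xk0; exists (2 * k)%N; rewrite exprM. Qed.

Lemma idempotent_compl (R : comNzRingType) (e : R) :
  idempotent_elt e -> idempotent_elt (1 - e).
Proof.
rewrite /idempotent_elt => ee.
have -> : (1 - e) * (1 - e) = 1 - e - e + e * e by ring.
by rewrite ee; ring.
Qed.

Lemma nil_clean_addl (R : comNzRingType) (n x : R) :
  nilpotent_elt n -> nil_clean x -> nil_clean (n + x).
Proof.
move=> nn [m [e [nm ee ->]]]; exists (n + m), e.
by split=> //; [apply: nilpotent_add | rewrite addrA].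
Qed.

Lemma nil_clean_mul_idempotent (R : comNzRingType) (x e : R) :
  nil_clean x -> idempotent_elt e -> nil_clean (x * e).
Proof.
case=> n [g [nn gg ->]] ee; exists (n * e), (g * e); split.
- exact: nilpotent_mulr.
- by rewrite /idempotent_elt mulrACA gg ee.
- by rewrite mulrDl.
Qed.

Lemma weak_nil_clean_three (R : comNzRingType) :
  weak_nil_clean_ring R -> nil_clean (3 : R).
Proof.
move=> hR; have [m [g [nm gg [E | E]]]] := hR 3; first by exists m, g.
have n12 : nilpotent_elt (12 : R).
  (* In [3 + 3 ^+ 2] with [3 = m - g], the terms [- g] and [g * g = g] cancel, leaving a multiple of
     [m]. *)
  have -> : 12 = m * (m - 2 * g + 1) :> R.
    have -> : 12 = 3 + 3 * 3 :> R by ring.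
    rewrite E.
    have -> : (m - g) * (m - g) = m * m - 2 * m * g + g * g by ring.
    by rewrite gg; ring.
  exact: nilpotent_mulr.
have n6 : nilpotent_elt (6 : R).
  apply: nilpotent_sqr; have -> : 6 ^+ 2 = 12 * 3 :> R by ring.
  exact: nilpotent_mulr.
exists (6 - m), g; split=> //; first exact: nilpotent_sub.
have -> : g = m - 3 by rewrite E; ring.
ring.
Qed.

Lemma weak_nil_clean_double_idempotent (R : comNzRingType) (e : R) :
  weak_nil_clean_ring R -> idempotent_elt e ->
  nilpotent_elt (2 * e) \/ nilpotent_elt (2 * e - 2).
Proof.
move=> hR ee; have [n [f [nn ff E]]] := hR (2 * e - 1).
have sqr1 : (2 * e - 1) * (2 * e - 1) = 1.
  have -> : (2 * e - 1) * (2 * e - 1) = 4 * (e * e) - 4 * e + 1 by ring.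
  by rewrite ee; ring.
case: E => E; rewrite E in sqr1.
- right; have nf : nilpotent_elt (1 - f).
    have -> : 1 - f = n * (n + 2 * f).
      (* Writing [1] as [(n + f) ^+ 2] and [f] as [f * f] makes the difference a polynomial
         identity. *)
      by rewrite -[X in X - _]sqr1 -[X in _ - X]ff; ring.
    exact: nilpotent_mulr.
  have -> : 2 * e - 2 = n - (1 - f).
    have -> : 2 * e - 2 = 2 * e - 1 - 1 by ring.
    by rewrite E; ring.
  exact: nilpotent_sub.
(* Again [f] is [1] up to a nilpotent, but the sign now puts [2 * e - 1] near [- 1] instead of
   [1]. *)
- left; have nf : nilpotent_elt (1 - f).
    have -> : 1 - f = n * (n - 2 * f).
      by rewrite -[X in X - _]sqr1 -[X in _ - X]ff; ring.
    exact: nilpotent_mulr.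
  have -> : 2 * e = n + (1 - f).
    have -> : 2 * e = 2 * e - 1 + 1 by ring.
    by rewrite E; ring.
  exact: nilpotent_add.
Qed.

Lemma weak_nil_clean_add1_or_add2 (R : comNzRingType) (x : R) :
  weak_nil_clean_ring R -> nil_clean (x + 1) \/ nil_clean (x + (1 + 1)).
Proof.
move=> hR; have [n [e [nn ee [-> | ->]]]] := hR x; last first.
  left; exists n, (1 - e); split=> //; first exact: idempotent_compl.
  by ring.
have [n2 | n2] := weak_nil_clean_double_idempotent hR ee.
- left; exists (n + 2 * e), (1 - e); split; last by ring.
    exact: nilpotent_add.
  exact: idempotent_compl.
(* The factor [e] stays in the last term: it is idempotent, so [3 * e] inherits nil cleanness from
   [3]. *)
- right; have -> : n + e + (1 + 1) = n - (2 * e - 2) + 3 * e by ring.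
  apply: nil_clean_addl; first exact: nilpotent_sub.
  by apply: nil_clean_mul_idempotent => //; apply: weak_nil_clean_three.
Qed.

Theorem theorem3p6 (R : finComNzRingType) (hR : weak_nil_clean_ring R) :
  dominating_set (nil_clean_graph R) [set (1 : R); 1 + 1].
Proof.
move=> x; have [xS | xNS] := boolP (x \in [set (1 : R); 1 + 1]); first by left.
(* Adjacency requires distinct vertices, which holds here because [x] lies outside the set. *)
have neq y : y \in [set (1 : R); 1 + 1] -> x <> y.
  by move=> yS xy; rewrite xy yS in xNS.
have S1 : (1 : R) \in [set (1 : R); 1 + 1] by rewrite !inE eqxx.
have S2 : (1 + 1 : R) \in [set (1 : R); 1 + 1] by rewrite !inE eqxx orbT.
right; have [c | c] := weak_nil_clean_add1_or_add2 x hR.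
- by exists 1 => //; split=> //; apply: neq.
- by exists (1 + 1) => //; split=> //; apply: neq.
Qed.
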